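(* Let $b>-1$, $\eta>0$, and let $(\beta_n)_{n\ge0}$, $(\gamma_n)_{n\ge1}$ be real sequences with $\gamma_n\ne0$ for $n\ge1$; put $\gamma_{-1}=\gamma_0=0$. Suppose that $$n\eta(\beta_n-\beta_{n-1}-1)=(-\gamma_{n+1}+\gamma_{n-1})\gamma_n\qquad\text{for all } n\in\mathbb N.$$ Then the system $$\beta_{n+1}=\frac{\eta(n+1)}{\gamma_{n+1}}-\beta_n+n-b,\qquad \gamma_{n+1}=\eta-\gamma_n-\beta_n^2-b\beta_n+\frac{\gamma_{n-1}\gamma_n}{\eta}+\frac{\eta n^2}{\gamma_n}\qquad (n\in\mathbb N_0)$$ (the term $\eta n^2/\gamma_n$ being read as $0$ for $n=0$) is equivalent to the system $$\beta_{n+1}=\frac{\eta(n+1)}{\gamma_{n+1}}-\beta_n+n-b,\qquad (\gamma_{n+1}-\eta)(\gamma_n-\eta)=\eta(\beta_n-n)(\beta_n-n+b)\qquad (n\in\mathbb N_0).$$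
   Context: $\mathbb N=\{1,2,\dots\}$, $\mathbb N_0=\{0,1,2,\dots\}$. (The sequences of interest are the recursion coefficients, in $zP_n(z)=P_{n+1}(z)+\beta_nP_n(z)+\gamma_nP_{n-1}(z)$, of the monic polynomials orthogonal with respect to the generalized Charlier weight $w(k)=\frac{\eta^k}{(b+1)_kk!}$ on $\mathbb N_0$.) *)

(* Defs.v *)
From mathcomp Require Export all_boot all_order all_algebra.
From mathcomp Require Export reals.

Set Implicit Arguments.
Unset Strict Implicit.
Unset Printing Implicit Defensive.

(* Main.v *)
(* The two systems share the equation for [beta], so they may be compared one
   [n] at a time. That equation at [n - 1] eliminates [beta_(n-1)] and the Toda
   relation eliminates [gamma_(n-1)]; the second equations of the two systems
   then differ by the factor [- eta]. At [n = 0] no elimination is needed. *)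
Require Import Defs.
From mathcomp Require Import all_boot all_order all_algebra.
From mathcomp Require Import reals ring.

Set Implicit Arguments.
Unset Strict Implicit.
Unset Printing Implicit Defensive.

Import Order.TTheory GRing.Theory Num.Theory.
Local Open Scope ring_scope.


(** The case of index [m >= 1]: [x], [x'] stand for [beta] at [m], [m - 1], and [g''], [g], [g'] for
    [gamma] at [m + 1], [m], [m - 1]. *)
Lemma quadratic_eq_iff (F : fieldType) (eta b m x x' g g' g'' : F) :
    eta != 0 -> g != 0 ->
    x = eta * m / g - x' + (m - 1) - b ->
    m * eta * (x - x' - 1) = (- g'' + g') * g ->
  g'' = eta - g - x ^+ 2 - b * x + g' * g / eta + eta * m ^+ 2 / g <->
  (g'' - eta) * (g - eta) = eta * (x - m) * (x - m + b).
Proof.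
move=> eta0 g0 hx htoda.
have hx' : x' = eta * m / g - x + (m - 1) - b by rewrite {1}hx; ring.
have hg' : g' = g'' + m * eta * (x - x' - 1) / g by rewrite htoda; field.
(* After substitution, the [eta * m ^+ 2 / g] coming from [x'] cancels the explicit one. *)
have key : (g'' - eta) * (g - eta) - eta * (x - m) * (x - m + b)
    = - eta * (g'' - (eta - g - x ^+ 2 - b * x + g' * g / eta
                      + eta * m ^+ 2 / g)).
  by rewrite hg' hx'; field; rewrite eta0 g0.
split=> [e|/eqP].
  by apply/eqP; rewrite -subr_eq0 key -e subrr mulr0.
by rewrite -subr_eq0 key mulf_eq0 oppr_eq0 (negPf eta0) /= subr_eq0 => /eqP.
Qed.

Theorem proposition13 (R : realType) (b eta : R)
    (beta : nat -> R) (gamma : int -> R)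
    (hb : -1 < b) (heta : 0 < eta)
    (hgamma : forall n : nat, (1 <= n)%N -> gamma n%:Z != 0)
    (hgammaN1 : gamma (-1) = 0) (hgamma0 : gamma 0 = 0)
    (htoda : forall n : nat, (1 <= n)%N ->
       n%:R * eta * (beta n - beta n.-1 - 1)
       = (- gamma (n%:Z + 1) + gamma (n%:Z - 1)) * gamma n%:Z) :
  (forall n : nat,
     beta n.+1
       = eta * (n%:R + 1) / gamma (n%:Z + 1) - beta n + n%:R - b
     /\
     gamma (n%:Z + 1)
       = eta - gamma n%:Z - beta n ^+ 2 - b * beta n
         + gamma (n%:Z - 1) * gamma n%:Z / eta
         + (if n == 0%N then 0 else eta * n%:R ^+ 2 / gamma n%:Z))
  <->
  (forall n : nat,
     beta n.+1
       = eta * (n%:R + 1) / gamma (n%:Z + 1) - beta n + n%:R - b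
     /\
     (gamma (n%:Z + 1) - eta) * (gamma n%:Z - eta)
       = eta * (beta n - n%:R) * (beta n - n%:R + b)).
Proof.
have eta0 : eta != 0 by rewrite gt_eqF.
(* The [beta] equation is assumed at every [k], since the equivalence at [n] uses it at [n - 1]. *)
suff second_iff n :
    (forall k, beta k.+1
       = eta * (k%:R + 1) / gamma (k%:Z + 1) - beta k + k%:R - b) ->
    gamma (n%:Z + 1)
       = eta - gamma n%:Z - beta n ^+ 2 - b * beta n
         + gamma (n%:Z - 1) * gamma n%:Z / eta
         + (if n == 0%N then 0 else eta * n%:R ^+ 2 / gamma n%:Z) <->
    (gamma (n%:Z + 1) - eta) * (gamma n%:Z - eta)
       = eta * (beta n - n%:R) * (beta n - n%:R + b).
  by split=> H n; have [hbeta hn] := H n; split=> //;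
     apply/(second_iff n) => // k; have [] := H k.
move=> hbeta; case: n => [|n] /=.
  (* As [gamma 0 = 0], the product equation carries the factor [- eta]; cancelling it leaves the
     formula for [gamma 1]. *)
  rewrite hgamma0 mulr0 mul0r !addr0 !subr0 sub0r.
  split=> [->|e]; first by ring.
  suff : gamma (0%:Z + 1) - eta = - (beta 0%N * (beta 0%N + b)).
    by move/eqP; rewrite subr_eq => /eqP ->; ring.
  apply: (mulIf (x := - eta)); first by rewrite oppr_eq0.
  by rewrite e; ring.
apply: (quadratic_eq_iff (x' := beta n)) => //; first exact: hgamma.
(* Here [m] is [n.+1], so [m - 1] is the [n] of the [beta] equation at [n]. *)
- by rewrite hbeta -natr1 addrK -addn1 PoszD.
- exact: (htoda n.+1).
Qed.
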